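(* Each of the following holds. (i) Some $4$-connected planar triangulations are not $(2,1)$-decomposable. (ii) Some Hamiltonian planar triangulations are not $(2,2)$-decomposable. (iii) Some planar triangulations are not $(2,3)$-decomposable.
   Context: All graphs are finite, undirected and simple. A planar triangulation is a maximally planar graph. A graph $G=(V,E)$ is $4$-connected if $|V|\ge 5$ and for every triple $S$ of vertices the graph $G-S$ is connected. A Hamiltonian path in $G$ is a simple path in $G$ that contains all vertices of $G$, and $G$ is called Hamiltonian if it contains at least one Hamiltonian path. For positive integers $k,d$, a graph is $(k,d)$-decomposable if its edges decompose (that is, its edge set can be partitioned) into $k$ forests and one subgraph of maximum degree at most $d$. *)

(* Defs.v *)
From HB Require Import structures.
From mathcomp Require Import all_boot all_order all_algebra.
From mathcomp Require Import all_classical all_reals all_analysis.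

Set Implicit Arguments.
Unset Strict Implicit.
Unset Printing Implicit Defensive.

Import Order.TTheory GRing.Theory Num.Theory.
Import numFieldNormedType.Exports.

Local Open Scope ring_scope.

(* The vertex set is a parameter, so that graphs on the same vertices can be
   compared. *)
Record sgraph (V : finType) := SGraph {
  adj :> rel V;
  adj_sym : symmetric adj;
  adj_irrefl : irreflexive adj
}.

Definition edges (V : finType) (G : sgraph V) : {set {set V}} :=
  [set [set p.1; p.2] | p : V * V & G p.1 p.2].

Definition four_connected (V : finType) (G : sgraph V) : Prop :=
  (5 <= #|V|)%N /\
  forall S : {set V}, #|S| = 3%N ->
    {in ~: S &, forall x y,
      connect [rel u v | [&& u \notin S, v \notin S & G u v]] x y}.

Definition hamiltonian (V : finType) (G : sgraph V) : Prop :=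
  exists (x : V) (p : seq V),
    [/\ path G x p, uniq (x :: p) & forall v : V, v \in x :: p].

(* Adjacency in the spanning subgraph with edge set [S]. *)
Definition adj_in (V : finType) (S : {set {set V}}) : rel V :=
  fun x y => [set x; y] \in S.

(* In a simple graph, [ucycle] also accepts the sequences [::] and [:: x; y]
   with x, y adjacent; a cycle has at least three vertices. *)
Definition is_forest (V : finType) (S : {set {set V}}) : Prop :=
  forall c : seq V, (3 <= size c)%N -> ~ ucycle (adj_in S) c.

Definition max_degree_le (V : finType) (d : nat) (S : {set {set V}}) : Prop :=
  forall x : V, (#|[set y | adj_in S x y]| <= d)%N.

(* As usual for decompositions, the parts may have no edges. *)
Definition decomposable (k d : nat) (V : finType) (G : sgraph V) : Prop :=
  exists (F : 'I_k -> {set {set V}}) (D : {set {set V}}),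
    [/\ edges G = (\bigcup_(i < k) F i) :|: D,
        forall i j : 'I_k, i != j -> [disjoint F i & F j],
        forall i : 'I_k, [disjoint F i & D],
        forall i : 'I_k, is_forest (F i)
      & max_degree_le d D].

(* [pos] places the vertices in the plane and, for each edge [e], the
   restriction of [arc e] to [0, 1] is the curve representing [e] (traversed
   in either direction); values of [arc] outside [0, 1], or on sets that are
   not edges, are irrelevant. *)
Definition plane_drawing (R : realType) (V : finType) (G : sgraph V)
    (pos : V -> R * R) (arc : {set V} -> R -> R * R) : Prop :=
  [/\ injective pos,
      forall e, e \in edges G ->
        {within `[0, 1], continuous (arc e)}%classic /\
        {in `[0, 1] &, injective (arc e)},
      forall x y, G x y ->
        (arc [set x; y] 0 = pos x /\ arc [set x; y] 1 = pos y) \/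
        (arc [set x; y] 0 = pos y /\ arc [set x; y] 1 = pos x),
      forall e v, e \in edges G ->
        {in `]0, 1[, forall t, arc e t <> pos v}
    & forall e f, e \in edges G -> f \in edges G -> e != f ->
        {in `]0, 1[ &, forall s t, arc e s <> arc f t}].

Definition planar (R : realType) (V : finType) (G : sgraph V) : Prop :=
  exists pos arc, @plane_drawing R V G pos arc.

(* Maximal planarity: no edge can be added between existing vertices without
   destroying planarity. *)
Definition planar_triangulation (R : realType) (V : finType) (G : sgraph V)
    : Prop :=
  planar R G /\
  forall H : sgraph V, subrel G H -> planar R H -> subrel H G.

(* Main.v *)
(** Let a graph with at least 3n - 6 edges split into two forests and a part D of
   maximum degree d, and let k of its n vertices have degree at most 3. A vertex
   of degree at most 3 is isolated in one of the forests for each of its edges in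
   D beyond the first, and each isolated vertex makes a forest smaller; counting
   edges gives 2 N + k <= d N + 8 with N = n - k.

   The double wheel with rim 11 has N = 13; placing a vertex of degree 3 in none,
   in half or in all of its faces gives k = 0, 11, 22 and contradicts this for
   d = 1, 2, 3. These graphs are drawn with straight segments. They are maximal
   planar because adding any edge produces a subdivision of K5.

   K5 is not planar for a discrete topological reason. Along fine polygonal
   chains, the direction from a point of one edge to a point of a disjoint edge,
   rounded to the four axis directions, gives a map from the deleted product of
   K5 to a 4-cycle that commutes with the antipodal maps. The parity [theta] of
   passages through one side of the 4-cycle vanishes around every square of the
   deleted product; summing over all pairs of disjoint edges yields 0 = 1. *)

From Stdlib Require Import ZArith.
Require Import Defs.
From mathcomp Require Import all_boot all_order all_algebra.
From mathcomp Require Import all_classical all_reals all_analysis.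
From mathcomp Require Import lra ring zify ssrZ.

Set Implicit Arguments.
Unset Strict Implicit.
Unset Printing Implicit Defensive.

Import Order.TTheory GRing.Theory Num.Theory.
Import numFieldNormedType.Exports.

Local Open Scope ring_scope.

(** * Discrete directions and the nonplanarity of K5 *)

(* [(k, s)] encodes the direction of sign [s] along the first axis if [k], along
   the second one otherwise; these four directions form a 4-cycle *)
Definition theta (l m : bool * bool) : bool := [&& l.2, m.2 & l.1 != m.1].

Definition side (l : bool * bool) : bool := l.1 (+) l.2.

Definition antipode (l : bool * bool) : bool * bool := (l.1, ~~ l.2).

(** Pairwise non-antipodal directions take at most two values, one per axis, and a closed walk on
    two values switches between them an even number of times. *)
Lemma theta_cell l00 l01 l11 l10 :
  l01 != antipode l00 -> l11 != antipode l01 -> l10 != antipode l11 ->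
  l10 != antipode l00 -> l11 != antipode l00 -> l10 != antipode l01 ->
  theta l00 l01 (+) theta l10 l11 = theta l00 l10 (+) theta l01 l11.
Proof. by move: l00 l01 l11 l10 => [[] []] [[] []] [[] []] [[] []]. Qed.

(** [theta] counts one edge of the 4-cycle and its antipodal image the opposite edge; [side] changes
    exactly across these two. *)
Lemma theta_antipode l m : m != antipode l ->
  theta (antipode l) (antipode m) = theta l m (+) (side l (+) side m).
Proof. by move: l m => [[] []] [[] []]. Qed.

Section Direction.
Variable R : realType.
Implicit Types (z p q x y : R * R) (s : seq (R * R)) (eps : R).

Definition direction z : bool * bool :=
  (`|z.2| <= `|z.1|, 0 < if `|z.2| <= `|z.1| then z.1 else z.2).

Lemma directionN z : z != 0 -> direction (- z) = antipode (direction z).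
Proof.
case: z => a b nz; rewrite /direction /antipode /= !normrN; congr (_, _).
have [ba|ab] := leP `|b| `|a|; rewrite oppr_gt0 -leNgt lt_neqAle.
  have [a0|//] := eqVneq a 0; move: ba nz.
  by rewrite a0 normr0 normr_le0 => /eqP ->; rewrite eqxx.
have [b0|//] := eqVneq b 0; move: ab.
by rewrite b0 normr0 normr_lt0.
Qed.

(** The dominant coordinate of [z] has absolute value at least [eps], so a change smaller than [eps]
    cannot reverse its sign. *)
Lemma direction_close z z' eps :
  eps <= `|z| -> `|z - z'| < eps -> direction z' != antipode (direction z).
Proof.
case: z z' => [a b] [a' b']; rewrite !prod_normE /= le_max gt_max => ez /andP[].
rewrite !ltr_norml => /andP[a1 a2] /andP[b1 b2].
apply/eqP; rewrite /direction /antipode /= => -[eqk].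
rewrite eqk; have [ba|ab] := leP `|b| `|a|.
  have {}ez : eps <= `|a| by case/orP: ez => // /le_trans; apply.
  move: ez; case: (ltrP 0 a) => [a0|a0] ez; case: (ltrP 0 a') => // a'0 _.
    by rewrite gtr0_norm // in ez; lra.
  by rewrite ler0_norm // in ez; lra.
have {}ez : eps <= `|b| by case/orP: ez => // /le_trans; apply; apply: ltW.
move: ez; case: (ltrP 0 b) => [a0|a0] ez; case: (ltrP 0 b') => // a'0 _.
  by rewrite gtr0_norm // in ez; lra.
by rewrite ler0_norm // in ez; lra.
Qed.

Fixpoint turns (f : R * R -> bool * bool) x s : bool :=
  if s is y :: s' then theta (f x) (f y) (+) turns f y s' else false.

Definition dist x y : R := `|x - y|.

Lemma distC x y : dist x y = dist y x.
Proof. exact: distrC. Qed.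

Lemma distxx x : dist x x = 0.
Proof. by rewrite /dist subrr normr0. Qed.

Definition chain eps : R * R -> seq (R * R) -> bool :=
  path (fun x y => dist x y < eps).

(** Twice [eps], so that both points may move by less than [eps] without reversing the direction. *)
Definition far eps s s' : Prop :=
  {in s & s', forall x y, eps + eps <= dist x y}.

Lemma corner_close eps x x' y y' : eps + eps <= dist x y ->
  dist x x' < eps -> dist y y' < eps ->
  direction (x' - y') != antipode (direction (x - y)).
Proof.
move=> d xx' yy'; apply: direction_close d _.
have -> : x - y - (x' - y') = (x - x') - (y - y').
  by rewrite !opprB addrACA [RHS]addrACA; congr (_ + _); rewrite addrC.
by apply: le_lt_trans (ler_normB _ _) _; apply: ltrD.
Qed.

(** [theta_cell] is summed over the squares of the strip; sides shared by neighbouring squares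
    cancel. *)
Lemma turns_strip eps x x' y s : 0 < eps -> dist x x' < eps -> chain eps y s ->
  far eps [:: x; x'] (y :: s) ->
  turns (fun r => direction (x - r)) y s
    (+) turns (fun r => direction (x' - r)) y s =
  theta (direction (x - y)) (direction (x' - y))
    (+) theta (direction (x - last y s)) (direction (x' - last y s)).
Proof.
move=> e0 xx'; elim: s y => [|y' s IH] y /=; first by rewrite addbb.
move=> /andP[yy' ys] d.
have {}IH := IH _ ys (fun a b ha hb => d a b ha (@mem_behead _ (y :: _) _ hb)).
have cxy a b : a \in [:: x; x'] -> b \in [:: y; y'] -> eps + eps <= dist a b.
  move=> ax; rewrite !inE => byy'; apply: d => //.
  by case/orP: byy' => /eqP->; rewrite !inE eqxx ?orbT.
have x0 (a : R * R) : dist a a < eps by rewrite distxx.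
have x'x : dist x' x < eps by rewrite distC.
have y'y : dist y' y < eps by rewrite distC.
have cell : theta (direction (x - y)) (direction (x - y'))
    (+) theta (direction (x' - y)) (direction (x' - y')) =
  theta (direction (x - y)) (direction (x' - y))
    (+) theta (direction (x - y')) (direction (x' - y')).
  by apply: theta_cell; apply: (corner_close (eps := eps)) => //; apply: cxy;
    rewrite !inE eqxx ?orbT.
by rewrite addbACA cell IH -!addbA addKb.
Qed.

(** Strips are glued along common sides, so [theta] sums to zero around the boundary of the product
    of the two chains. *)
Lemma turns_rectangle eps x s y t : 0 < eps -> chain eps x s -> chain eps y t ->
  far eps (x :: s) (y :: t) ->
  turns (fun q => direction (q - y)) x s
    (+) turns (fun q => direction (q - last y t)) x s =
  turns (fun r => direction (x - r)) y t
    (+) turns (fun r => direction (last x s - r)) y t.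
Proof.
move=> e0; elim: s x => [|x' s IH] x /= xs yt d; first by rewrite addbb.
case/andP: xs => xx' xs.
have /IH : chain eps x' s by [].
have d' : far eps (x' :: s) (y :: t).
  by move=> a b ha; apply: d; apply: (@mem_behead _ (x :: _)).
move=> /(_ yt d') {}IH.
have strip : turns (fun r => direction (x - r)) y t
    (+) turns (fun r => direction (x' - r)) y t =
  theta (direction (x - y)) (direction (x' - y))
    (+) theta (direction (x - last y t)) (direction (x' - last y t)).
  apply: (turns_strip e0) => // a b ha; apply: d.
  by move: ha; rewrite !inE => /orP[]->; rewrite ?orbT.
by rewrite addbACA -strip IH -!addbA addKb.
Qed.

Lemma turns_antipode eps p x s : 0 < eps -> chain eps x s ->
  far eps (x :: s) [:: p] ->
  turns (fun q => direction (p - q)) x s =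
  turns (fun q => direction (q - p)) x s
    (+) (side (direction (x - p)) (+) side (direction (last x s - p))).
Proof.
move=> e0; elim: s x => [|x' s IH] x /=; first by rewrite addbb.
move=> /andP[xx' xs] d.
have d' : far eps (x' :: s) [:: p].
  by move=> a b ha; apply: d; apply: (@mem_behead _ (x :: _)).
have nz z : z \in [:: x, x' & s] -> z - p != 0.
  move=> hz; rewrite -normr_gt0; apply: (lt_le_trans _ (d z p hz _)).
    by rewrite addr_gt0.
  by rewrite inE.
rewrite IH // -(opprB x) -(opprB x') !directionN ?nz ?inE ?eqxx ?orbT //.
rewrite theta_antipode; last first.
  apply: (corner_close (eps := eps)) => //; last by rewrite distxx.
  by apply: d; rewrite inE ?eqxx.
by case: theta; case: turns; case: side; case: side; case: side.
Qed.

Section Chains.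
Variables (eps : R) (p : nat -> R * R) (c : nat -> nat -> seq (R * R)).
Hypothesis eps_gt0 : 0 < eps.
Hypothesis c_chain :
  forall i j, (i < j < 5)%N -> chain eps (p i) (c i j) /\ last (p i) (c i j) = p j.
Hypothesis c_far : forall i j k l, (i < j < 5)%N -> (k < l < 5)%N ->
  uniq [:: i; j; k; l] -> far eps (p i :: c i j) (p k :: c k l).

Let arm i j k := turns (fun q => direction (q - p k)) (p i) (c i j).
Let dir i j := side (direction (p i - p j)).

(** This is the boundary of the rectangle over two disjoint edges; [turns_antipode] converts the two
    sides on which the second point moves, at the cost of the [dir] terms. *)
Lemma arm_square i j k l : (i < j < 5)%N -> (k < l < 5)%N ->
  uniq [:: i; j; k; l] ->
  arm i j k (+) arm i j l (+) (arm k l i (+) arm k l j) =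
  dir k i (+) dir l i (+) (dir k j (+) dir l j).
Proof.
move=> ij kl u; have [cij eij] := c_chain ij; have [ckl ekl] := c_chain kl.
have d := c_far ij kl u.
have := turns_rectangle eps_gt0 cij ckl d; rewrite eij ekl /arm => ->.
rewrite (turns_antipode eps_gt0 ckl) ?(turns_antipode (p := p j) eps_gt0 ckl).
- by rewrite ekl /dir; do 2!case: turns; do 4!case: side.
- by move=> a b ha; rewrite inE => /eqP ->; rewrite distC; apply: d ha;
    rewrite -eij mem_last.
- by move=> a b ha; rewrite inE => /eqP ->; rewrite distC; apply: d ha; rewrite mem_head.
Qed.

Lemma dirN i j k l : (i < j < 5)%N -> (k < l < 5)%N -> uniq [:: i; j; k; l] ->
  [/\ dir k i = ~~ dir i k, dir k j = ~~ dir j k,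
      dir l i = ~~ dir i l & dir l j = ~~ dir j l].
Proof.
move=> ij kl u; have [cij eij] := c_chain ij; have [ckl ekl] := c_chain kl.
have d := c_far ij kl u.
have swap x y : x \in p i :: c i j -> y \in p k :: c k l ->
    side (direction (y - x)) = ~~ side (direction (x - y)).
  move=> hx hy; rewrite -opprB directionN; first by rewrite /side /= addbN.
  by rewrite -normr_gt0; apply: lt_le_trans (d x y hx hy); rewrite addr_gt0.
by split; apply: swap; rewrite ?mem_head // -?eij -?ekl mem_last.
Qed.

Let triple i j k := arm i j k (+) arm i k j (+) arm j k i.

(* In the sum of the squares of the three pairs of disjoint edges of K4, the
   sides at [i] cancel, and each pair of other vertices leaves a side and its
   opposite *)
Lemma quadruple i j k l : (i < j)%N -> (j < k)%N -> (k < l < 5)%N ->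
  triple i j k (+) triple i j l (+) triple i k l (+) triple j k l.
Proof.
move=> ij jk /andP[kl l5].
have [jl ik] := (ltn_trans jk kl, ltn_trans ij jk).
have [il k5] := (ltn_trans ij jl, ltn_trans kl l5).
have j5 := ltn_trans jk k5.
have := @arm_square i j k l; have := @arm_square i k j l.
have := @arm_square i l j k.
have := @dirN i j k l; have := @dirN i k j l.
rewrite /= !inE ij ik il jk jl kl l5 k5 j5.
have neq a b : (a < b)%N -> (a == b = false) * (b == a = false).
  by move=> ab; rewrite (eq_sym b) ltn_eqF.
rewrite !(neq _ _ ij, neq _ _ ik, neq _ _ il, neq _ _ jk, neq _ _ jl, neq _ _ kl) /=.
move=> /(_ isT isT isT)[-> _ -> ->] /(_ isT isT isT)[-> -> _ ->].
move=> /(_ isT isT isT) eil /(_ isT isT isT) eik /(_ isT isT isT) eij.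
(* The twelve arms are regrouped by the three pairs of opposite edges. *)
rewrite /triple (AC (3*3*3*3)
  ((((1*4)*(9*12))*((2*7)*(6*11)))*((5*8)*(3*10)))) /= eij eik eil.
by do 6!case: dir.
Qed.

(** Each of the ten triples lies in two of the five quadruples, so the five sums add up to zero,
    whereas five odd parities add up to one. *)
Lemma no_K5_chains : False.
Proof.
have := quadruple (i := 0) (j := 1) (k := 2) (l := 3) isT isT isT.
have := quadruple (i := 0) (j := 1) (k := 2) (l := 4) isT isT isT.
have := quadruple (i := 0) (j := 1) (k := 3) (l := 4) isT isT isT.
have := quadruple (i := 0) (j := 2) (k := 3) (l := 4) isT isT isT.
have := quadruple (i := 1) (j := 2) (k := 3) (l := 4) isT isT isT.
by do 10!case: triple.
Qed.

End Chains.

End Direction.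

(** * Chains in connected sets and separation of compact sets *)

Lemma dist_ball (R : realType) (p q : R * R) (e : R) : ball p e q = (dist p q < e).
Proof. by rewrite -ball_normE. Qed.

(** The points reachable by such chains form a nonempty, relatively open and closed subset of
    [A]. *)
Lemma connected_chain (R : realType) (A : set (R * R)) (p q : R * R) (eps : R) :
  connected A -> 0 < eps -> A p -> A q ->
  exists s, [/\ chain eps p s, last p s = q & forall z, z \in s -> A z].
Proof.
move=> cA e0 Ap Aq.
pose B : set (R * R) := fun z => A z /\
  exists s, [/\ chain eps p s, last p s = z & forall y, y \in s -> A y].
have step a b : A a -> B b -> dist b a < eps -> B a.
  move=> Aa [_ [s [ps bs sA]]] ba; split=> //; exists (rcons s a); split.
  - by rewrite /chain rcons_path bs ba andbT.
  - by rewrite last_rcons.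
  - by move=> y; rewrite mem_rcons inE => /predU1P[->//|/sA].
have union_open (D : set (R * R)) :
    open (\bigcup_(a in D) ball a eps)%classic.
  by apply: bigcup_open => a _; apply: ball_open.
suff BA : B = A by have [] : B q by rewrite BA.
apply: cA.
- by exists p; split=> //; exists [::].
- exists (\bigcup_(a in B) ball a eps)%classic => //.
  apply/seteqP; split=> [z Bz|z [Az [b Bb]]].
    by split; [case: Bz | exists z => //; apply: ballxx].
  by rewrite dist_ball; apply: step.
- exists (~` (\bigcup_(a in A `\` B) ball a eps))%classic.
    by apply: open_closedC.
  apply/seteqP; split=> [z Bz|z [Az nz]].
    split; first by case: Bz.
    move=> [a [Aa nBa]]; rewrite dist_ball => az; apply: nBa.
    by apply: step Bz _; rewrite // distC.
  apply: contrapT => nBz; apply: nz; exists z; first by split.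
  exact: ballxx.
Qed.

(** The set of differences is compact, hence closed, and misses zero, so some ball around zero
    misses it too. *)
Lemma compact_dist_gt0 (R : realType) (A B : set (R * R)) :
  compact A -> compact B -> (forall x y, A x -> B y -> x <> y) ->
  exists2 d : R, 0 < d & forall x y, A x -> B y -> d <= dist x y.
Proof.
move=> cA cB AB.
pose f (z : (R * R) * (R * R)) : R * R := z.1 - z.2.
have cf : compact (f @` (A `*` B))%classic.
  apply: continuous_compact; last exact: compact_setX.
  by apply: continuous_subspaceT => z; apply: sub_continuous.
have clf : closed (f @` (A `*` B))%classic.
  by apply: compact_closed cf; apply: norm_hausdorff.
have /nbhs_ballP[d d0 dP] : nbhs (0 : R * R) (~` (f @` (A `*` B)))%classic.
  apply: open_nbhs_nbhs; split; first exact: closed_openC.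
  move=> [[x y] [/= Ax By]] /eqP; rewrite subr_eq0 => /eqP; exact: AB.
exists d => // x y Ax By; rewrite leNgt; apply/negP => xy.
apply: (dP (x - y)); last by exists (x, y).
by rewrite dist_ball distC /dist subr0.
Qed.

Lemma edgesP (V : finType) (G : sgraph V) (e : {set V}) :
  reflect (exists x y, G x y /\ e = [set x; y]) (e \in edges G).
Proof.
apply: (iffP imsetP) => [[[x y] xy ->]|[x [y [xy ->]]]].
  by exists x, y; rewrite inE in xy.
by exists (x, y); rewrite ?inE.
Qed.

Lemma edges_adj (V : finType) (G : sgraph V) (x y : V) :
  ([set x; y] \in edges G) = G x y.
Proof.
apply/edgesP/idP => [[u [v [uv eq_e]]]|xy]; last by exists x, y.
have: x \in [set u; v] by rewrite -eq_e set21.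
have: y \in [set u; v] by rewrite -eq_e set22.
have: u \in [set x; y] by rewrite eq_e set21.
have: v \in [set x; y] by rewrite eq_e set22.
rewrite !inE => /orP[]/eqP vE /orP[]/eqP uE;
  rewrite -?vE -?uE ?uE ?vE ?[G y x]adj_sym // in uv *;
  by rewrite adj_irrefl in uv.
Qed.

(** * Chains along the edges of a plane drawing *)

Section Drawing.
Variables (R : realType) (V : finType) (H : sgraph V).
Variables (pos : V -> R * R) (arc : {set V} -> R -> R * R).
Hypothesis drawing : plane_drawing H pos arc.

Let trace e := (arc e @` `[0, 1])%classic.

Lemma trace_compact e : e \in edges H -> compact (trace e).
Proof.
case: drawing => _ + _ _ _ => /[apply] -[ce _].
by apply: continuous_compact => //; apply: segment_compact.
Qed.

Lemma trace_connected e : e \in edges H -> connected (trace e).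
Proof.
case: drawing => _ + _ _ _ => /[apply] -[ce _].
by apply: connected_continuous_connected => //; apply: segment_connected.
Qed.

Lemma trace_ends x y : H x y ->
  trace [set x; y] (pos x) /\ trace [set x; y] (pos y).
Proof.
have t0 : `[0, 1]%classic (0 : R) by rewrite /= in_itv /= lexx ler01.
have t1 : `[0, 1]%classic (1 : R) by rewrite /= in_itv /= lexx ler01.
case: drawing => _ _ + _ _ => /[apply] -[] [e0 e1]; split;
  by [exists 0|exists 1].
Qed.

Lemma trace_cases e t : e \in edges H -> t \in `[0, 1] ->
  (exists2 v, v \in e & arc e t = pos v) \/ t \in `]0, 1[.
Proof.
case: drawing => _ _ ends _ _ /edgesP[x [y [xy ->]]].
rewrite !in_itv /= !le_eqVlt => /andP[/predU1P[<-|t0] /predU1P[t1|t1]].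
- by move/eqP: t1; rewrite eq_sym oner_eq0.
- left; have [[-> _]|[-> _]] := ends _ _ xy;
    by [exists x; rewrite ?set21|exists y; rewrite ?set22].
- rewrite t1; left; have [[_ ->]|[_ ->]] := ends _ _ xy;
    by [exists x; rewrite ?set21|exists y; rewrite ?set22].
- by right; rewrite t0.
Qed.

Lemma trace_disjoint e f : e \in edges H -> f \in edges H -> [disjoint e & f] ->
  forall p q, trace e p -> trace f q -> p <> q.
Proof.
case: drawing => inj _ _ vtx cross eH fH ef p q [s s01 <-] [t t01 <-].
have neq : e != f.
  have [x [y [_ eE]]] := edgesP _ _ eH.
  apply: contraTneq ef => <-; rewrite -finset.setI_eq0 finset.setIid eE.
  by apply/finset.set0Pn; exists x; rewrite set21.
have [[u ue eu]|s'] := trace_cases eH s01; have [[v vf fv]|t'] := trace_cases fH t01.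
- rewrite eu fv => /inj uv; move/disjointFr: ef => /(_ u ue).
  by rewrite uv vf.
- by rewrite eu => /esym; apply: vtx.
- by rewrite fv; apply: vtx.
- exact: cross.
Qed.

(** For each of the finitely many pairs of edges all small positive [d] work, so some [d] works for
    all pairs. *)
Lemma trace_separation : exists2 d : R, 0 < d &
  forall e f, e \in edges H -> f \in edges H -> [disjoint e & f] ->
    forall p q, trace e p -> trace f q -> d <= dist p q.
Proof.
pose Q (ef : {set V} * {set V}) d := ef.1 \in edges H -> ef.2 \in edges H ->
  [disjoint ef.1 & ef.2] ->
  forall p q, trace ef.1 p -> trace ef.2 q -> d <= dist p q.
have Qnear ef : (\forall d \near 0^'+, Q ef d)%classic.
  case: ef => e f; rewrite /Q /=.
  have [[eH fH ef]|nef] := pselect [/\ e \in edges H, f \in edges H & [disjoint e & f]];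
    last by near=> d => eH fH ef; case: nef.
  have [d d0 dP] :=
    compact_dist_gt0 (trace_compact eH) (trace_compact fH) (trace_disjoint eH fH ef).
  near=> d' => _ _ _ p q ep fq; apply: le_trans (dP p q ep fq).
  by near: d'; apply: nbhs_right_le.
have : (\forall d \near 0^'+, 0 < d /\ forall ef, Q ef d)%classic.
  by apply: filterI; [apply: nbhs_right_gt | apply: (@filter_forall _ _ Q _ _ Qnear)].
by move=> /filter_ex[d [d0 dQ]]; exists d => // e f; apply: (dQ (e, f)).
Unshelve. all: by end_near.
Qed.

(** Chains along successive arcs are concatenated; each point keeps an edge within the walk, to
    which [trace_separation] can be applied. *)
Lemma walk_chain (eps : R) x w : 0 < eps -> path H x w ->
  exists s, [/\ chain eps (pos x) s, last (pos x) s = pos (last x w) &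
    forall z, z \in s -> exists e, [/\ e \in edges H, {subset e <= x :: w} & trace e z]].
Proof.
move=> e0; elim: w x => [|y w IH] x /=; first by exists [::].
case/andP => xy /IH[s [cs es sP]].
have eH : [set x; y] \in edges H by rewrite edges_adj.
have [tx ty] := trace_ends xy.
have [s' [cs' es' s'P]] := connected_chain (trace_connected eH) e0 tx ty.
exists (s' ++ s); split; first by rewrite /chain cat_path es'; apply/andP.
  by rewrite last_cat es'.
move=> z; rewrite mem_cat => /orP[/s'P tz|/sP[e [eH' ew tz]]].
  exists [set x; y]; split=> // v; rewrite !inE => /orP[]/eqP->; by rewrite eqxx ?orbT.
by exists e; split=> // v /ew; rewrite !inE => ->; rewrite orbT.
Qed.

End Drawing.

(* The subdivided edges may be arbitrary walks, and only those belonging to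
   disjoint edges of K5 must not meet *)
Lemma K5_subdivision_nonplanar (R : realType) (V : finType) (H : sgraph V)
    (b : nat -> V) (w : nat -> nat -> seq V) :
  (forall i j, (i < j < 5)%N ->
     [/\ w i j != [::], path H (b i) (w i j) & last (b i) (w i j) = b j]) ->
  (forall i j k l, (i < j < 5)%N -> (k < l < 5)%N -> uniq [:: i; j; k; l] ->
     ~~ has (mem (b i :: w i j)) (b k :: w k l)) ->
  ~ planar R H.
Proof.
move=> walks indep [pos [arc draw]].
have [d d0 dP] := trace_separation draw.
(* Half the separation, as [far] asks for twice the step of the chains. *)
have e0 : 0 < d / 2 by rewrite divr_gt0.
pose good i j s := [/\ chain (d / 2) (pos (b i)) s, last (pos (b i)) s = pos (b j) &
  forall z, z \in pos (b i) :: s ->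
    exists e, [/\ e \in edges H, {subset e <= b i :: w i j} &
      (arc e @` `[0, 1])%classic z]].
have /choice[c cP] ij : exists s, (ij.1 < ij.2 < 5)%N -> good ij.1 ij.2 s.
  case: ij => i j /=; have [/walks[]|] := boolP (i < j < 5)%N; last by exists [::].
  case eqw: (w i j) => [//|y w'] _ p l; have [s [cs es sP]] := walk_chain draw e0 p.
  exists s => _; rewrite /good eqw; split=> //; first by rewrite es l.
  move=> z; rewrite inE => /predU1P[->|/sP //].
  (* The starting point lies on the first edge of the walk, which exists because the walk is
     nonempty. *)
  have /andP[xy _] := p; exists [set b i; y]; split.
  - by rewrite edges_adj.
  - by move=> v; rewrite !inE => /orP[]/eqP->; rewrite eqxx ?orbT.
  - by have [] := trace_ends draw xy.
apply: (@no_K5_chains R (d / 2) (pos \o b) (fun i j => c (i, j)) e0).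
  by move=> i j /(cP (i, j))[].
move=> i j k l ij kl u x y.
move=> /(let: And3 _ _ P := cP (i, j) ij in P _)[e [eH es te]].
move=> /(let: And3 _ _ P := cP (k, l) kl in P _)[f [fH fs tf]].
rewrite -splitr; apply: dP eH fH _ _ _ te tf.
rewrite disjoint_subset; apply/fintype.subsetP => v /es ve; rewrite inE.
apply: contra (indep _ _ _ _ ij kl u) => /fs vf; apply/hasP; by exists v.
Qed.

(** * Counting edges *)

Section Forests.
Variable V : finType.
Implicit Types (S F : {set {set V}}) (e : {set V}) (x y v : V).
Local Open Scope nat_scope.

Definition neighbours S x : {set V} := [set y | adj_in S x y].

Lemma adj_in_sym S x y : adj_in S x y = adj_in S y x.
Proof. by rewrite /adj_in finset.setUC. Qed.

Lemma pairE e x : #|e| = 2 -> x \in e -> exists2 y, x != y & e = [set x; y].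
Proof.
move=> /eqP/cards2P[a [b [ab ->]]]; rewrite !inE => /orP[]/eqP->.
  by exists b.
by exists a; rewrite 1?eq_sym // finset.setUC.
Qed.

Lemma handshake S : {in S, forall e, #|e| = 2} ->
  \sum_x #|neighbours S x| = 2 * #|S|.
Proof.
move=> S2.
have nbr x : #|neighbours S x| = #|[set e in S | x \in e]|.
  rewrite -(@card_in_imset _ _ (fun y => [set x; y])).
    apply: eq_card => e; rewrite !inE; apply/imsetP/andP => [[y]|[eS xe]].
      by rewrite inE /adj_in => xyS ->; rewrite set21.
    by have [y xy eE] := pairE (S2 e eS) xe; exists y; rewrite // inE /adj_in -eE.
  move=> y z; rewrite !inE /adj_in => xy xz eqyz.
  have: y \in [set x; z] by rewrite -eqyz set22.
  rewrite !inE => /orP[/eqP yx|/eqP //].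
  by have := S2 _ xy; rewrite yx finset.setUid cards1.
under eq_bigr do rewrite nbr -sum1_card.
rewrite (exchange_big_dep (mem S)) /=; last by move=> x e _; rewrite inE => /andP[].
rewrite (eq_bigr (fun=> 2)) => [|e eS]; first by rewrite sum_nat_const mulnC.
by rewrite -(S2 e eS) -sum1_card; apply: eq_bigl => x; rewrite inE eS.
Qed.

(** Without a leaf, any path extends at its head: the head has a second neighbour, which would close
    a cycle if it were on the path. This yields paths with more than [#|V|] vertices. *)
Lemma forest_leaf F e : {in F, forall e, #|e| = 2} -> is_forest F -> e \in F ->
  exists x, #|neighbours F x| = 1.
Proof.
move=> F2 forestF eF; apply: contrapT => noleaf.
have irr x : ~~ adj_in F x x.
  by apply/negP => /F2; rewrite finset.setUid cards1.
have long n : exists x y p,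
    [/\ path (adj_in F) x (y :: p), uniq [:: x, y & p] & size p = n].
  elim: n => [|n [x [y [p [xp up sp]]]]].
    have [x xe] : exists x, x \in e by apply/card_gt0P; rewrite F2.
    have [y xy eE] := pairE (F2 e eF) xe.
    by exists x, y, [::]; rewrite /= inE xy /adj_in -eE eF.
  have Nxy : y \in neighbours F x by rewrite inE; case/andP: xp.
  have /card_gt0P[z] : 0 < #|neighbours F x :\ y|.
    have := cardsD1 y (neighbours F x); rewrite Nxy.
    by case: #|_ :\ y| => // cx; case: noleaf; exists x.
  rewrite !inE => /andP[zy xz].
  have zx : z != x by apply: contraTneq xz => ->.
  have [zp|zp] := boolP (z \in p); last first.
    exists z, x, (y :: p); split; last by rewrite /= sp.
      by move: xp; rewrite /= (adj_in_sym _ z) xz.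
    by rewrite cons_uniq up !inE !negb_or zx zy zp.
  case/splitPr: zp xp up {sp} => p1 p2.
  rewrite /= cat_path /= -/(uniq _) => /and4P[xy yp1 p1z _].
  rewrite !inE !mem_cat !inE !negb_or cat_uniq /= !negb_or.
  move=> /and5P[/and4P[nxy xp1 _ _] /and3P[yp1' _ _] up1 /andP[zp1 _] _].
  exfalso; apply: (forestF (x :: y :: rcons p1 z)); first by rewrite /= size_rcons.
  rewrite /ucycle; apply/andP; split.
    by rewrite /= !rcons_path /= last_rcons xy yp1 p1z /= adj_in_sym xz.
  rewrite /= rcons_uniq !inE !mem_rcons !inE !negb_or nxy xp1 yp1' up1 zp1.
  by rewrite eq_sym zx eq_sym zy.
have [x [y [p [_ u sp]]]] := long #|V|.
by have := max_card [in [:: x, y & p]]; rewrite (card_uniqP u) /= sp ltnNge leqnSn.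
Qed.

Lemma neighbours_cover S x : {in S, forall e, #|e| = 2} ->
  (x \in finset.cover S) = (neighbours S x != finset.set0).
Proof.
move=> S2; apply/bigcupP/finset.set0Pn => [[e eS xe]|[y]].
  by have [y _ eE] := pairE (S2 e eS) xe; exists y; rewrite inE /adj_in -eE.
by rewrite inE => xy; exists [set x; y]; rewrite ?set21.
Qed.

(** Induction on the number of edges: deleting the edge at a leaf [x] also uncovers [x], and the
    last edge covers two vertices. *)
Lemma forest_card F : {in F, forall e, #|e| = 2} -> is_forest F ->
  F != finset.set0 -> #|F| < #|finset.cover F|.
Proof.
elim: {F}_.+1 {-2}F (ltnSn #|F|) => // n IH F Fn F2 forestF /finset.set0Pn[e0 e0F].
have [x /eqP/cards1P[y Ny]] := forest_leaf F2 forestF e0F.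
set e := [set x; y].
have eF : e \in F.
  by have : y \in neighbours F x; [rewrite Ny set11 | rewrite inE].
have xcov : x \in finset.cover F by apply/bigcupP; exists e; rewrite ?set21.
pose F' := F :\ e.
have F'F : {subset F' <= F} by move=> f; rewrite !inE => /andP[].
have F'2 : {in F', forall e, #|e| = 2} by move=> f /F'F /F2.
have covF' : finset.cover F' \subset finset.cover F :\ x.
  apply/fintype.subsetP => z /bigcupP[f fF' zf]; rewrite !inE; apply/andP; split.
    apply: contraTneq fF' => zx; rewrite zx in zf.
    rewrite /F' !inE; have [fF|] := boolP (f \in F); rewrite ?andbF // andbT negbK.
    have [v _ fE] := pairE (F2 f fF) zf.
    have : v \in neighbours F x by rewrite inE /adj_in -fE.
    by rewrite Ny inE => /eqP vy; rewrite fE vy.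
  by apply/bigcupP; exists f => //; apply: F'F.
have cF : #|F| = #|F'|.+1 by rewrite (cardsD1 e F) eF.
have cC : #|finset.cover F| = #|finset.cover F :\ x|.+1.
  by rewrite (cardsD1 x (finset.cover F)) xcov.
have leC := subset_leq_card covF'.
have [F'0|F'0] := eqVneq F' finset.set0.
  rewrite cF F'0 cards0 -(F2 e eF); apply: subset_leq_card.
  by apply/fintype.subsetP => z ze; apply/bigcupP; exists e.
have forestF' : is_forest F'.
  move=> c c3 /andP[cyc uc]; apply: (forestF c c3); rewrite /ucycle uc andbT.
  by apply: sub_cycle cyc => a b; apply: F'F.
have := IH F' _ F'2 forestF' F'0; lia.
Qed.

Lemma decomposable_bound (d : nat) (G : sgraph V) (B : {set V}) :
  decomposable 2 d G -> (forall v, v \in B -> #|[set y | G v y]| <= 3) ->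
  0 < #|~: B| -> 3 * #|V| <= #|edges G| + 6 ->
  2 * #|~: B| + #|B| <= d * #|~: B| + 8.
Proof.
move=> [F [D [EG disjF disjFD forestF maxD]]] degB A0 E.
pose F0 := F ord0; pose F1 := F ord_max.
have disj01 : [disjoint F0 & F1] by apply: disjF.
have {}EG : edges G = F0 :|: F1 :|: D.
  rewrite EG !big_ord_recl big_ord0 finset.setU0; congr (_ :|: _ :|: _).
  by congr F; apply: val_inj.
have card2 (S : {set {set V}}) : S \subset edges G -> {in S, forall e, #|e| = 2}.
  move=> /fintype.subsetP SG e /SG /edgesP[x [y [xy ->]]]; rewrite cards2.
  by case: eqP xy => // ->; rewrite adj_irrefl.
have F0E : F0 \subset edges G by rewrite EG -finset.setUA finset.subsetUl.
have F1E : F1 \subset edges G by rewrite EG finset.setUAC finset.subsetUr.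
have DE : D \subset edges G by rewrite EG finset.subsetUr.
have cardE : #|edges G| = #|F0| + #|F1| + #|D|.
  rewrite EG !cardsU.
  have /eqP -> : (F0 :|: F1) :&: D == finset.set0.
    by rewrite finset.setIUl finset.setU_eq0 !finset.setI_eq0 !disjFD.
  by move: disj01; rewrite -finset.setI_eq0 => /eqP ->; rewrite cards0 !subn0.
(* A nonempty forest has fewer edges than covered vertices; for an empty one, a vertex outside [B]
   gives the extra 1. *)
have forest_bound (S : {set {set V}}) : S \subset edges G -> is_forest S ->
    #|S| + 1 + #|B :\: finset.cover S| <= #|V|.
  move=> SE forestS.
  have cB : #|B :\: finset.cover S| <= #|~: finset.cover S|.
    by apply: subset_leq_card; rewrite finset.setDE finset.subsetIr.
  have cV := cardsC (finset.cover S); have cB' := cardsC B.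
  have [S0|/(forest_card (card2 S SE) forestS)] := eqVneq S finset.set0; last by lia.
  have := subset_leq_card (finset.subsetDl B (finset.cover S)).
  have : #|S| = 0 by rewrite S0 cards0.
  lia.
(* Each forest covering [v] takes at least one of its at most three edges. *)
have degD v : v \in B -> #|neighbours D v| <=
    1 + (v \in B :\: finset.cover F0) + (v \in B :\: finset.cover F1).
  move=> vB; have := degB v vB; rewrite !inE vB !andbT.
  have nb (S T : {set {set V}}) : [disjoint S & T] ->
      [disjoint neighbours S v & neighbours T v].
    move=> ST; rewrite -finset.setI_eq0; apply/eqP/setP => y; rewrite !inE.
    by apply/andP => -[/(disjointFr ST) + yT]; rewrite -/(adj_in T v y) yT.
  have : (neighbours F0 v :|: neighbours F1 v) :|: neighbours D v \subset [set y | G v y].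
    by apply/fintype.subsetP => y; rewrite !inE -edges_adj EG !inE.
  move=> /subset_leq_card; rewrite !cardsU finset.setIUl.
  have ni (S T : {set {set V}}) : [disjoint S & T] ->
      neighbours S v :&: neighbours T v = finset.set0.
    by move=> /nb; rewrite -finset.setI_eq0 => /eqP.
  rewrite (ni F0 D) ?(ni F1 D) ?(ni F0 F1) ?disjFD // finset.setU0 !cards0 !subn0.
  rewrite !neighbours_cover ?negbK; try exact: card2.
  rewrite -!cards_eq0; case: #|neighbours F0 v| => [|?];
    by case: #|neighbours F1 v| => [|?] /=; lia.
have hD : \sum_(v in B) #|neighbours D v| + \sum_(v | v \notin B) #|neighbours D v| =
    2 * #|D|.
  by rewrite -(handshake (card2 D DE)) [RHS](bigID (mem B)).
have sB : \sum_(v in B) #|neighbours D v| <=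
    #|B| + #|B :\: finset.cover F0| + #|B :\: finset.cover F1|.
  have sub (C : {set V}) : \sum_(v in B) (v \in B :\: C) = #|B :\: C|.
    rewrite -sum1_card big_mkcond [RHS]big_mkcond; apply: eq_bigr => v _.
    by rewrite inE; case: (v \in B); rewrite ?andbF //; case: (v \in C).
  apply: (@leq_trans
    (\sum_(v in B) (1 + (v \in B :\: finset.cover F0) + (v \in B :\: finset.cover F1)))).
    by apply: leq_sum.
  by rewrite !big_split /= sum1_card !sub.
have sA : \sum_(v | v \notin B) #|neighbours D v| <= d * #|~: B|.
  rewrite mulnC -sum_nat_const (eq_bigl (mem (~: B))).
    by apply: leq_sum => v _; apply: maxD.
  by move=> v; rewrite /= finset.in_setC.
(* Let [n = #|V|], let [N = #|~: B|], and let [i] be the number of isolated vertices of [B], summed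
   over both forests. Twice the edge count gives [6n - 12 <= 2(2n - 2 - i) + #|B| + i + d N]. *)
have := forest_bound F0 F0E (forestF _); have := forest_bound F1 F1E (forestF _).
move: hD sB sA cardE E A0 (cardsC B); lia.
Qed.

End Forests.

(** * Straight-line drawings *)

Section StraightLineDrawings.
Variable R : realType.
Implicit Types (a b c : R * R) (s t : R).

(** Twice the signed area of the triangle [a b c]. *)
Definition orient a b c : R :=
  (b.1 - a.1) * (c.2 - a.2) - (b.2 - a.2) * (c.1 - a.1).

Definition segment a b t : R * R :=
  ((1 - t) * a.1 + t * b.1, (1 - t) * a.2 + t * b.2).

Lemma segment_continuous a b : continuous (segment a b).
Proof.
have affine (u v : R) : continuous (fun t : R => (1 - t) * u + t * v).
  move=> t; apply: cvgD; apply: cvgM; try exact: cvg_cst; try exact: cvg_id.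
  by apply: cvgB; [apply: cvg_cst | apply: cvg_id].
move=> t; apply: (@cvg_pair _ _ _ _ (nbhs (segment a b t).1) (nbhs (segment a b t).2));
  exact: affine.
Qed.

Lemma segment_inj a b : a != b -> injective (segment a b).
Proof.
case: a b => a1 a2 [b1 b2] ab s t [] e1 e2; apply/eqP; apply: contraNT ab => st.
rewrite -subr_eq0 in st; apply/eqP; congr (_, _); apply/eqP; rewrite -subr_eq0;
  apply/eqP; apply: (mulfI st); lra.
Qed.

Lemma segment0 a b : segment a b 0 = a.
Proof. by case: a => a1 a2; rewrite /segment /= !subr0 !mul1r !mul0r !addr0. Qed.

Lemma segment1 a b : segment a b 1 = b.
Proof. by case: b => b1 b2; rewrite /segment /= !subrr !mul0r !mul1r !add0r. Qed.

Lemma orient_segment a b c d t :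
  orient a b (segment c d t) = (1 - t) * orient a b c + t * orient a b d.
Proof.
by rewrite /orient /segment /=; ring.
Qed.

Lemma orientaa a b : orient a b a = 0.
Proof. by rewrite /orient !subrr !mulr0 subrr. Qed.

Lemma orientbb a b : orient a b b = 0.
Proof. by rewrite /orient; ring. Qed.

(** Weak inequalities admit segments with a common end; the condition on the sum keeps [c] and [d]
    from both lying on the line [a b]. *)
Definition one_sided a b c d : Prop :=
  let o := orient a b c in let o' := orient a b d in
  (0 <= o /\ 0 <= o' /\ 0 < o + o') \/ (o <= 0 /\ o' <= 0 /\ o + o' < 0).

(** [orient a b] is affine along [c d], hence of strict sign inside that segment, but it vanishes on
    the line [a b]. *)
Lemma one_sided_disjoint a b c d s t : one_sided a b c d -> 0 < t < 1 ->
  segment a b s <> segment c d t.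
Proof.
move=> sided /andP[t0 t1] eq_st.
have t1' : 0 < 1 - t by rewrite subr_gt0.
have pos (u v : R) : 0 <= u -> 0 <= v -> 0 < u + v -> 0 < (1 - t) * u + t * v.
  rewrite le_eqVlt => /predU1P[<- _|u0 v0 _].
    by rewrite add0r mulr0 add0r; apply: mulr_gt0.
  by apply: ltr_wpDr; [apply: mulr_ge0 => //; apply: ltW | apply: mulr_gt0].
have := orient_segment a b c d t.
rewrite -eq_st orient_segment orientaa orientbb !mulr0 addr0 => /esym zero.
case: sided => [[]|[]] h [h' hh'].
  by have := pos _ _ h h' hh'; rewrite zero ltxx.
have := pos (- orient a b c) (- orient a b d).
rewrite !oppr_ge0 -opprD oppr_gt0 !mulrN -opprD zero oppr0 ltxx.
by move=> /(_ h h' hh').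
Qed.

(* [e] chooses one orientation of each edge *)
Lemma straight_planar (V : finType) (G : sgraph V) (e : rel V) (pos : V -> R * R) :
  (forall x y, G x y = e x y || e y x) -> injective pos ->
  (forall x y v, e x y -> v != x -> v != y -> orient (pos x) (pos y) (pos v) != 0) ->
  (forall x y z w, e x y -> e z w -> (x, y) != (z, w) ->
     one_sided (pos x) (pos y) (pos z) (pos w) \/
     one_sided (pos z) (pos w) (pos x) (pos y)) ->
  planar R G.
Proof.
move=> Ge inj vertex_edge edge_edge.
pose ends E := [pred p : V * V | e p.1 p.2 && (E == [set p.1; p.2])].
(* An edge is an unordered pair; picking its pair in [e] directs the segment. Sets that are not
   edges get a constant curve. *)
pose arc E :=
  if [pick p in ends E] is Some p then segment (pos p.1) (pos p.2) else fun=> 0.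
have arcE E : E \in edges G -> exists x y,
    [/\ e x y, E = [set x; y] & arc E = segment (pos x) (pos y)].
  move=> /edgesP[x [y [xy EE]]]; rewrite /arc.
  case: pickP => [[u v] /= /andP[uv /eqP ->]|none].
    by exists u, v.
  have := none (x, y); have := none (y, x).
  rewrite /= !inE /= EE eqxx finset.setUC eqxx !andbT => yx xy'.
  by rewrite Ge xy' yx in xy.
have neq x y : e x y -> x != y.
  by move=> exy; apply: contraFneq (adj_irrefl G x) => {2}->; rewrite Ge exy.
exists pos, arc; split=> //.
- move=> E /arcE[x [y [xy _ ->]]]; split.
    by apply: continuous_subspaceT; apply: segment_continuous.
  by move=> s t _ _; apply: segment_inj; apply: contra_neq (neq _ _ xy) => /inj.
- move=> x y xy; have /arcE[u [v [uv eqE ->]]] : [set x; y] \in edges G.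
    by rewrite edges_adj.
  rewrite segment0 segment1; have nuv := neq _ _ uv.
  have: u \in [set x; y] by rewrite eqE set21.
  have: v \in [set x; y] by rewrite eqE set22.
  rewrite !inE => /orP[]/eqP vE /orP[]/eqP uE; move: nuv; rewrite vE uE ?eqxx //.
    by right.
  by left.
- move=> E v /arcE[x [y [xy _ ->]]] t; rewrite in_itv /= => /andP[t0 t1] eqv.
  have [vx|vx] := eqVneq v x.
    rewrite vx -[RHS](segment0 _ (pos y)) in eqv.
    have /(_ _ _ eqv) t00 := segment_inj (contra_neq (@inj x y) (neq _ _ xy)).
    by rewrite t00 ltxx in t0.
  have [vy|vy] := eqVneq v y.
    rewrite vy -[RHS](segment1 (pos x)) in eqv.
    have /(_ _ _ eqv) t11 := segment_inj (contra_neq (@inj x y) (neq _ _ xy)).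
    by rewrite t11 ltxx in t1.
  have := vertex_edge x y v xy vx vy.
  by rewrite -eqv orient_segment orientaa orientbb !mulr0 addr0 eqxx.
- move=> E F /arcE[x [y [xy EE ->]]] /arcE[z [w [zw FE ->]]] EF s t.
  rewrite !in_itv /= => s01 t01.
  have xyzw : (x, y) != (z, w) by apply: contra_neq EF => -[xz yw]; rewrite EE FE xz yw.
  have [sided|sided] := edge_edge x y z w xy zw xyzw.
    exact: one_sided_disjoint.
  by move=> /esym; apply: one_sided_disjoint.
Qed.

End StraightLineDrawings.

(** * The graphs *)

Section Wheels.
Local Open Scope nat_scope.

Definition rim_next (r : nat) : nat := if r == 12 then 2 else r.+1.

(* Vertices 0 and 1 are the poles of a double wheel with rim 2, ..., 12;
   vertex 11 + r lies in the face bounded by 0, r and the next rim vertex, and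
   22 + r in the corresponding face at 1 *)
Definition wheel_edge (x y : nat) : bool :=
  match x with
  | 0 => 2 <= y < 24
  | 1 => (2 <= y < 13) || (24 <= y < 35)
  | _ => (x < 13) && [|| y == rim_next x, y == x + 11, y == x + 22,
           (13 <= y < 24) && (rim_next (y - 11) == x) |
           (24 <= y < 35) && (rim_next (y - 22) == x)]
  end.

Definition wheel_adj (x y : nat) : bool := wheel_edge x y || wheel_edge y x.

Lemma wheel_edge_irrefl x : wheel_edge x x = false.
Proof.
by do 13!(case: x => [//|x]).
Qed.

Lemma wheel_sym n : symmetric (fun x y : 'I_n => wheel_adj x y).
Proof. by move=> x y; apply: orbC. Qed.

Lemma wheel_irrefl n : irreflexive (fun x y : 'I_n => wheel_adj x y).
Proof. by move=> x; rewrite /wheel_adj wheel_edge_irrefl. Qed.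

(** Initial segments of the numbering give all examples: 13 vertices form the double wheel, 24 also
    fill the faces at pole 0, and 35 fill all faces. *)
Definition wheel n : sgraph 'I_n := SGraph (@wheel_sym n) (@wheel_irrefl n).

Lemma forall_iotaP n (P : pred nat) : reflect (forall x, x < n -> P x) (all P (iota 0 n)).
Proof.
apply: (iffP allP) => [h x xn|h x]; last by rewrite mem_iota => /h.
by apply: h; rewrite mem_iota.
Qed.

(** * Degree counts and non-decomposability *)

Lemma card_ord_count n (P : pred nat) : #|[set x : 'I_n | P x]| = count P (iota 0 n).
Proof.
rewrite cardsE cardE size_filter -val_enum_ord count_map.
by rewrite enumT.
Qed.

Definition wheel_degree n x := count (wheel_adj x) (iota 0 n).

Lemma card_wheel_edges n :
  2 * #|edges (wheel n)| = \sum_(0 <= x < n) wheel_degree n x.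
Proof.
rewrite -handshake; last first.
  move=> e /edgesP[x [y [xy ->]]]; rewrite cards2.
  by case: eqP xy => // ->; rewrite adj_irrefl.
rewrite big_mkord; apply: eq_bigr => x _; rewrite /wheel_degree -card_ord_count.
by apply: eq_card => y; rewrite !inE /adj_in edges_adj.
Qed.

(** With the [n - 13] face vertices as [B], the bound of [decomposable_bound] reads
    [13 + n <= 13 d + 8]. *)
Lemma wheel_not_decomposable d n : n \in [:: 13; 24; 35] ->
  d * 13 + 8 < 13 + n -> ~ decomposable 2 d (wheel n).
Proof.
move=> n_in dn dec.
have sumn_deg :
    \sum_(0 <= x < n) wheel_degree n x = sumn (map (wheel_degree n) (iota 0 n)).
  by rewrite /index_iota subn0 sumnE big_map.
(* The last conjunct is the edge bound, doubled because the degree sum counts each edge twice. *)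
have check : [&& count (fun x => 13 <= x) (iota 0 n) + 13 == n,
  count (predC (fun x => 13 <= x)) (iota 0 n) == 13,
  all (fun x => (13 <= x) ==> (wheel_degree n x <= 3)) (iota 0 n) &
  6 * n <= sumn (map (wheel_degree n) (iota 0 n)) + 12].
  by move: n_in; rewrite !inE => /or3P[] /eqP ->; vm_compute.
have /and4P[/eqP cB /eqP cA /forall_iotaP deg3 cE] := check.
have := @decomposable_bound _ d (wheel n) [set x : 'I_n | 13 <= x] dec.
have -> : ~: [set x : 'I_n | 13 <= x] = [set x : 'I_n | ~~ (13 <= x)].
  by apply/setP => x; rewrite !inE.
rewrite (card_ord_count n (fun x => ~~ (13 <= x))) card_ord_count cA card_ord.
have := card_wheel_edges n; rewrite sumn_deg => cE'.
move=> h; suff : 2 * 13 + count (fun x => 13 <= x) (iota 0 n) <= d * 13 + 8 by lia.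
apply: h => //; last by lia.
move=> v; rewrite inE => v13; have := deg3 v (ltn_ord v); rewrite v13 implyTb;
by rewrite /wheel_degree -card_ord_count.
Qed.

(** * Integer coordinates of the drawing *)

Section IntegerPoints.
Local Open Scope Z_scope.

(** The rim lies on the parabola [4 y = x ^ 2], with pole 0 inside and pole 1 far below. The outer
    face of the double wheel is then 1, 2, 12, so its vertex 34 is placed far outside. *)
Definition coordinates : seq (Z * Z) := [:: (-8, 84); (0, -176); (-20, 100);
  (-16, 64); (-12, 36); (-8, 16); (-4, 4); (0, 0); (4, 4); (8, 16); (12, 36);
  (16, 64); (20, 100); (-13, 83); (-11, 67); (-9, 55); (-7, 47); (-5, 43);
  (-3, 43); (-1, 47); (1, 55); (3, 67); (5, 83); (-4, 92); (-9, -47);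
  (-7, -63); (-5, -75); (-3, -83); (-1, -87); (1, -87); (3, -83); (5, -75);
  (7, -63); (9, -47); (84, 276)].

Definition point x := nth (0, 0) coordinates x.

Definition orientZ (x y z : nat) : Z :=
  let: (a1, a2) := point x in let: (b1, b2) := point y in
  let: (c1, c2) := point z in
  (b1 - a1) * (c2 - a2) - (b2 - a2) * (c1 - a1).

Definition one_sidedZ x y z w : bool :=
  let o := orientZ x y z in let o' := orientZ x y w in
  [&& 0 <=? o, 0 <=? o' & 0 <? o + o'] || [&& o <=? 0, o' <=? 0 & o + o' <? 0].

End IntegerPoints.

Definition wheel_edge_seq : seq (nat * nat) :=
  [seq p <- [seq (x, y) | x <- iota 0 35, y <- iota 0 35] | wheel_edge p.1 p.2].

Lemma mem_wheel_edge_seq x y : x < 35 -> y < 35 -> wheel_edge x y ->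
  (x, y) \in wheel_edge_seq.
Proof.
move=> xn yn xy; rewrite mem_filter; apply/andP; split=> //; apply/allpairsP.
by exists (x, y); rewrite !mem_iota.
Qed.

Definition straight_check : bool :=
  all (fun p => all (fun v => (v == p.1) || (v == p.2) ||
      ~~ Z.eqb (orientZ p.1 p.2 v) 0) (iota 0 35)) wheel_edge_seq &&
  all (fun p => all (fun q => (p == q) ||
      one_sidedZ p.1 p.2 q.1 q.2 || one_sidedZ q.1 q.2 p.1 p.2) wheel_edge_seq)
    wheel_edge_seq.

Lemma straight_checkT : straight_check.
Proof. by vm_compute. Qed.

End Wheels.

Section Planarity.
Variable R : realType.

(** Orientations are computed on binary integers; their signs are carried to [R] along this ring
    morphism. *)
Definition real_of_Z (z : Z) : R := (int_of_Z z)%:~R.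

Lemma real_of_ZB u v : real_of_Z (Z.sub u v) = real_of_Z u - real_of_Z v.
Proof. by rewrite /real_of_Z -intrB -raddfB. Qed.

Lemma real_of_ZD u v : real_of_Z (Z.add u v) = real_of_Z u + real_of_Z v.
Proof. by rewrite /real_of_Z -intrD -raddfD. Qed.

Lemma real_of_ZM u v : real_of_Z (Z.mul u v) = real_of_Z u * real_of_Z v.
Proof. by rewrite /real_of_Z -intrM -rmorphM. Qed.

Lemma real_of_Z_ge0 z : (Z.leb 0 z) = (0 <= real_of_Z z).
Proof. by rewrite ler0z; case: z. Qed.

Lemma real_of_Z_gt0 z : (Z.ltb 0 z) = (0 < real_of_Z z).
Proof. by rewrite ltr0z; case: z => // p /=; rewrite ?ltz_nat; lia. Qed.

Lemma real_of_Z_le0 z : (Z.leb z 0) = (real_of_Z z <= 0).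
Proof. by rewrite lerz0; case: z => // p /=; lia. Qed.

Lemma real_of_Z_lt0 z : (Z.ltb z 0) = (real_of_Z z < 0).
Proof. by rewrite ltrz0; case: z => // p /=; lia. Qed.

Definition wheel_point x : R * R := (real_of_Z (point x).1, real_of_Z (point x).2).

Lemma orient_wheel_point x y z :
  orient (wheel_point x) (wheel_point y) (wheel_point z) = real_of_Z (orientZ x y z).
Proof.
rewrite /orient /wheel_point /orientZ.
case: (point x) (point y) (point z) => a1 a2 [b1 b2] [c1 c2] /=.
by rewrite !(real_of_ZB, real_of_ZM).
Qed.

Lemma one_sided_wheel_point x y z w : one_sidedZ x y z w ->
  one_sided (wheel_point x) (wheel_point y) (wheel_point z) (wheel_point w).
Proof.
rewrite /one_sidedZ /one_sided !orient_wheel_point -real_of_ZD.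
rewrite !real_of_Z_ge0 real_of_Z_gt0 !real_of_Z_le0 real_of_Z_lt0.
by case/orP => /and3P[]; [left|right].
Qed.

Lemma wheel_planar n : (n <= 35)%N -> planar R (wheel n).
Proof.
move=> n35; have lt35 (x : 'I_n) : (x < 35)%N := leq_trans (ltn_ord x) n35.
have := straight_checkT; rewrite /straight_check.
move=> /andP[/allP vertex_edge /allP edge_edge].
apply: (@straight_planar R _ (wheel n) (fun x y => wheel_edge x y)
  (fun x => wheel_point x)).
- by [].
- move=> x y [/intr_inj/(can_inj int_of_ZK) e1 /intr_inj/(can_inj int_of_ZK) e2].
  have coord_uniq : uniq coordinates by vm_compute.
  apply/val_inj/(uniqP (Z0, Z0) coord_uniq); rewrite ?inE ?lt35 //.
  by rewrite -!/(point _) [LHS]surjective_pairing e1 e2 -surjective_pairing.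
- move=> x y v xy vx vy.
  have /forall_iotaP := vertex_edge _ (mem_wheel_edge_seq (lt35 x) (lt35 y) xy).
  move=> /(_ v (lt35 v)); move: vx vy; rewrite -!val_eqE /= => /negbTE-> /negbTE->.
  rewrite orient_wheel_point intr_eq0; apply: contra => /eqP o0; apply/Z.eqb_eq.
  exact: (can_inj int_of_ZK).
- move=> x y z w xy zw ne.
  have /allP := edge_edge _ (mem_wheel_edge_seq (lt35 x) (lt35 y) xy).
  move=> /(_ _ (mem_wheel_edge_seq (lt35 z) (lt35 w) zw)) /=.
  have -> : (val x, val y) == (val z, val w) = false.
    by apply: contraNF ne => /eqP[/val_inj-> /val_inj->].
  by case/orP => /one_sided_wheel_point; [left|right].
Qed.

End Planarity.

(** * Maximality through subdivisions of K5 *)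

Section Walks.
Local Open Scope nat_scope.

Lemma path_insubd n (x0 : 'I_n) (e : rel nat) (e' : rel 'I_n) k s :
  (forall u v : 'I_n, e u v -> e' u v) -> all (gtn n) (k :: s) -> path e k s ->
  path e' (insubd x0 k) (map (insubd x0) s).
Proof.
move=> ee' ks; rewrite path_map.
apply: (@sub_in_path _ (gtn n) e _ _ _ _ ks) => u v un vn uv /=.
by apply: ee'; rewrite !insubdK.
Qed.

(** Both ends are included; the arc runs upwards and passes from 12 to 2 if [r] exceeds [s]. *)
Definition rim_arc (r s : nat) : seq nat :=
  if r <= s then iota r (s - r).+1 else iota r (13 - r) ++ iota 2 s.-1.

(* For non-adjacent [x < y], the branch vertices and, without their initial
   vertices, the walks of a subdivision of K5 in the wheel with the edge [x y]
   added: row [i] lists the walks from branch vertex [i] to the later ones.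
   The other branch vertices are three neighbours of [y], unless [y] is a pole *)
Definition subdivision (x y : nat) : seq nat * seq (seq (seq nat)) :=
  if y == 1 then
    ([:: x; y; 2; 5; 8],
     [:: [:: [:: y]; [:: 2]; [:: 5]; [:: 8]]; [:: [:: 2]; [:: 5]; [:: 8]];
         [:: rim_arc 3 5; rev (rim_arc 8 12)]; [:: rim_arc 6 8]])
  else if y < 13 then
    let c := x.+1 in let prev := if x == 2 then 12 else x.-1 in
    ([:: x; y; 0; 1; c],
     [:: [:: [:: y]; [:: 0]; [:: 1]; [:: c]];
         [:: [:: 0]; [:: 1]; rev (iota c (y - c))];
         [:: [:: prev; 1]; [:: c]]; [:: [:: c]]])
  else
    let: (p, b) := if y < 24 then (0, y - 11) else (1, y - 22) in
    let q := 1 - p in let c := rim_next b in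
    let bx := if x < 24 then x - 11 else x - 22 in
    let: (xp, xb, xc) :=
      if x == q then ([:: rim_next c; p], [:: b], [:: c])
      else if x < 13 then ([:: p], behead (rim_arc x b), behead (rev (rim_arc c x)))
      else if (x < 24) == (y < 24) then
        ([:: p], rim_arc (rim_next bx) b, rev (rim_arc c bx))
      else if bx == b then ([:: q; rim_next c; p], [:: b], [:: c])
      else if bx == c then ([:: rim_next c; p], [:: q; b], [:: c])
      else ([:: bx; p], rim_arc (rim_next bx) b, [:: q; c]) in
    ([:: x; y; p; b; c],
     [:: [:: [:: y]; xp; xb; xc]; [:: [:: p]; [:: b]; [:: c]];
         [:: [:: b]; [:: c]]; [:: [:: c]]]).

Definition branch x y i := nth 0 (subdivision x y).1 i.

(** Row [i] begins with the walk to [i.+1], hence the shift. *)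
Definition walk x y i j := nth [::] (nth [::] (subdivision x y).2 i) (j - i.+1).

Definition adj_plus x y u v :=
  [|| wheel_adj u v, (u == x) && (v == y) | (u == y) && (v == x)].

Definition K5_edges := [seq p <- [seq (i, j) | i <- iota 0 5, j <- iota 0 5] | p.1 < p.2].

(** Besides [x] and [y] only vertices below 13 may occur, so one computation applies to each of the
    wheels containing [x] and [y]. *)
Definition check_subdivision x y : bool :=
  all (fun p => let b := branch x y p.1 in let w := walk x y p.1 p.2 in
    [&& w != [::], path (adj_plus x y) b w, last b w == branch x y p.2 &
        all (fun v => (v < 13) || (v == x) || (v == y)) (b :: w)]) K5_edges &&
  all (fun p => all (fun q => uniq [:: p.1; p.2; q.1; q.2] ==>
    ~~ has (mem (branch x y p.1 :: walk x y p.1 p.2))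
      (branch x y q.1 :: walk x y q.1 q.2)) K5_edges) K5_edges.

(** The two poles are completed by three vertices joined along the rim, two rim vertices by both
    poles and the successor of [x]. A face vertex [y] already spans a K4 with its three neighbours,
    to which [x] is joined by the new edge and three walks. *)
Lemma check_subdivisionT :
  all (fun y => all (fun x => wheel_adj x y || check_subdivision x y) (iota 0 y))
    (iota 0 35).
Proof. by vm_compute. Qed.

Lemma mem_K5_edges i j : i < j < 5 -> (i, j) \in K5_edges.
Proof.
move=> /andP[ij j5]; rewrite mem_filter; apply/andP; split=> //; apply/allpairsP.
by exists (i, j); rewrite !mem_iota /= j5 (ltn_trans ij j5).
Qed.

Lemma wheel_edge_added_nonplanar (R : realType) n (H : sgraph 'I_n) (x y : 'I_n) :
  12 < n <= 35 -> subrel (wheel n) H -> H x y -> x < y -> ~~ wheel n x y ->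
  ~ planar R H.
Proof.
move=> /andP[n13 n35] GH Hxy xy nGxy.
have := check_subdivisionT => /forall_iotaP/(_ y (leq_trans (ltn_ord y) n35)).
have nA : wheel_adj x y = false by apply: negbTE.
move=> /forall_iotaP/(_ x xy); rewrite nA orFb /check_subdivision.
move=> /andP[/allP walks /allP indep].
have bounded k s : all (fun v => (v < 13) || (v == x) || (v == y)) (k :: s) ->
    all (gtn n) (k :: s).
  apply: sub_all => v /orP[/orP[v13|/eqP ->]|/eqP ->] /=; [|exact: ltn_ord..].
  exact: leq_trans n13.
have adjH (u v : 'I_n) : adj_plus x y u v -> H u v.
  rewrite /adj_plus => /or3P[uv|/andP[/eqP/val_inj-> /eqP/val_inj->] //|].
    exact: GH.
  by move=> /andP[/eqP/val_inj-> /eqP/val_inj->]; rewrite adj_sym.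
apply: (@K5_subdivision_nonplanar R _ H (fun i => insubd x (branch x y i))
  (fun i j => map (insubd x) (walk x y i j))).
  move=> i j ij; have /and4P[/= w0 p /eqP l /bounded bd] := walks _ (mem_K5_edges ij).
  split; first by case: (walk _ _ _ _) w0.
    exact: path_insubd adjH bd p.
  by rewrite last_map l.
move=> i j k l ij kl u.
have /and4P[_ _ _ /bounded/allP bd1] := walks _ (mem_K5_edges ij).
have /and4P[_ _ _ /bounded/allP bd2] := walks _ (mem_K5_edges kl).
have /allP/(_ _ (mem_K5_edges kl)) := indep _ (mem_K5_edges ij).
move=> /implyP/(_ u); apply: contra => /hasP[z].
rewrite -!map_cons => /mapP[b bkl ->] /mapP[c cij] /(congr1 val).
rewrite !insubdK; [|exact: bd1|exact: bd2] => bc.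
by apply/hasP; exists b; rewrite // bc.
Qed.

Lemma wheel_triangulation (R : realType) n : 12 < n <= 35 ->
  planar_triangulation R (wheel n).
Proof.
move=> n_bounds; split; first by apply: wheel_planar; case/andP: n_bounds.
move=> H GH planarH x y Hxy; apply: contraT => nGxy; exfalso.
have [xy|yx|/val_inj eqxy] := ltngtP x y.
- exact: (wheel_edge_added_nonplanar n_bounds GH Hxy xy nGxy planarH).
- rewrite adj_sym in Hxy; rewrite adj_sym in nGxy.
  exact: (wheel_edge_added_nonplanar n_bounds GH Hxy yx nGxy planarH).
- by rewrite eqxy adj_irrefl in Hxy.
Qed.

(** * Hamiltonicity and 4-connectivity *)

Lemma wheel_hamiltonian : hamiltonian (wheel 24).
Proof.
(* From pole 1 on, each rim vertex is followed by the face vertex between it and the next one;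
   vertex 23 leads to pole 0. *)
pose s := flatten [seq [:: r; r + 11] | r <- iota 2 11] ++ [:: 0].
exists (insubd ord0 1), (map (insubd ord0) s).
have bd : all (gtn 24) (1 :: s) by vm_compute.
split.
- by apply: (@path_insubd _ _ wheel_adj) bd _ => //; vm_compute.
- rewrite -map_cons map_inj_in_uniq; first by vm_compute.
  by move=> u v /(allP bd) un /(allP bd) vn /(congr1 val); rewrite !insubdK.
- move=> v; rewrite -map_cons; apply/mapP; exists (val v); last by rewrite valKd.
  have /forall_iotaP : all (mem (1 :: s)) (iota 0 24) by vm_compute.
  by apply; apply: ltn_ord.
Qed.

Definition rim_step r u v :=
  [&& wheel_adj u v, u \notin [:: 0; 1; r] & v \notin [:: 0; 1; r]].

Lemma rim_connected r z : 1 < r < 13 -> 1 < z < 13 -> z != r ->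
  exists s, [/\ path (rim_step r) (rim_next r) s, last (rim_next r) s = z &
    all (gtn 13) (rim_next r :: s)].
Proof.
move=> /andP[r1 r13] /andP[z1 z13] zr; exists (behead (rim_arc (rim_next r) z)).
have : all (fun r => all (fun z => [&& 1 < r, 1 < z & z != r] ==>
    let s := behead (rim_arc (rim_next r) z) in
    [&& path (rim_step r) (rim_next r) s, last (rim_next r) s == z &
      all (gtn 13) (rim_next r :: s)]) (iota 0 13)) (iota 0 13) by vm_compute.
move=> /forall_iotaP/(_ r r13)/forall_iotaP/(_ z z13).
by rewrite r1 z1 zr implyTb => /and3P[p /eqP l bd].
Qed.

Lemma wheel_pole_rim n (p x : 'I_n) : p < 2 -> 1 < x < 13 -> wheel n p x.
Proof.
case: p => -[|[|//]] p_lt _ /andP[x1 x13]; apply/orP; left; rewrite /= x1 ?x13 //.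
exact: ltn_trans x13 _.
Qed.

(** A remaining pole reaches everything. If both poles are deleted, only one rim vertex [r] is, and
    the rest of the rim is a path starting after [r]. *)
Lemma wheel_four_connected : four_connected (wheel 13).
Proof.
split; first by rewrite card_ord.
move=> S S3; set e := (X in connect X).
have e_sym : connect_sym e.
  by apply: sym_connect_sym => u v; rewrite /e /= andbCA wheel_sym.
have through z : (forall x, x \notin S -> connect e z x) ->
    {in ~: S &, forall x y, connect e x y}.
  move=> cz x y; rewrite !finset.in_setC => xS yS.
  by apply: connect_trans (cz y yS); rewrite e_sym; apply: cz.
have small (x : 'I_13) : x < 13 := ltn_ord x.
have pole (p : 'I_13) : p < 2 -> p \notin S -> {in ~: S &, forall x y, connect e x y}.
  move=> p2 pS; have step (x : 'I_13) : 1 < x -> x \notin S -> e p x.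
    by move=> x1 xS; rewrite /e /= pS xS; apply: wheel_pole_rim; rewrite ?x1 ?small.
  apply: (through p) => x xS.
  have [x1|x1] := ltnP 1 x; first by apply: connect1; apply: step.
  (* Three deleted vertices cannot exhaust the eleven rim vertices; one that remains links [p] to
     the pole [x]. *)
  have /existsP[r /andP[r1 rS]] : [exists r : 'I_13, (1 < r) && (r \notin S)].
    apply: contraT => /existsPn none.
    have : [set r : 'I_13 | 1 < r] \subset S.
      apply/fintype.subsetP => r; rewrite inE => r1.
      by have := none r; rewrite r1 negbK.
    by move=> /subset_leq_card; rewrite S3 (card_ord_count 13 (fun r => 1 < r)).
  apply: connect_trans (connect1 (step r r1 rS)) (connect1 _).
  by rewrite /e /= rS xS wheel_sym; apply: wheel_pole_rim; rewrite ?r1 ?small.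
pose p0 : 'I_13 := ord0; pose p1 : 'I_13 := lift ord0 ord0.
have [p0S|] := boolP (p0 \in S); last exact: pole.
have [p1S|] := boolP (p1 \in S); last exact: pole.
have /eqP/cards1P[r rE] : #|S :\ p0 :\ p1| = 1.
  move: S3; rewrite (cardsD1 p0) p0S (cardsD1 p1) !inE p1S => /eqP.
  by rewrite !eqSS => /eqP.
have inS x : (x \in S) = (val x \in [:: 0; 1; val r]).
  have := erefl (x \in [set r]); rewrite -{1}rE !inE -!val_eqE /=.
  have [x1 _|x1] := eqVneq (val x) 1.
    by rewrite -[1]/(val p1) in x1; move/val_inj: x1 => ->; rewrite p1S orbT.
  have [x0 _|x0 /= ->] := eqVneq (val x) 0; last by [].
  by rewrite -[0]/(val p0) in x0; move/val_inj: x0 => ->.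
have r1 : 1 < r.
  have : r \in S :\ p0 :\ p1 by rewrite rE set11.
  by rewrite !inE -!val_eqE /=; case: (val r) => [|[|]] //; rewrite ?andbF.
apply: (through (insubd p0 (rim_next r))) => z zS; move: (zS).
rewrite inS !inE !negb_or => /and3P[z0 z1 zr].
have [|||s [p l bd]] := @rim_connected r z.
- by rewrite r1 small.
- by rewrite small andbT ltnNge leq_eqVlt ltnS leqn0 negb_or z0 z1.
- exact: zr.
apply/connectP; exists (map (insubd p0) s).
  apply: path_insubd bd p => u v; rewrite /rim_step /e /= !inS.
  by move=> /and3P[-> -> ->].
by rewrite last_map l valKd.
Qed.

End Walks.

Theorem theorem1p4 (R : realType) :
  (exists (V : finType) (G : sgraph V),
     [/\ four_connected G, planar_triangulation R G & ~ decomposable 2 1 G]) /\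
  (exists (V : finType) (G : sgraph V),
     [/\ hamiltonian G, planar_triangulation R G & ~ decomposable 2 2 G]) /\
  (exists (V : finType) (G : sgraph V),
     planar_triangulation R G /\ ~ decomposable 2 3 G).
Proof.
split; [|split].
- exists 'I_13, (wheel 13); split; first exact: wheel_four_connected.
    exact: wheel_triangulation.
  exact: wheel_not_decomposable.
- exists 'I_24, (wheel 24); split; first exact: wheel_hamiltonian.
    exact: wheel_triangulation.
  exact: wheel_not_decomposable.
- exists 'I_35, (wheel 35); split; first exact: wheel_triangulation.
  exact: wheel_not_decomposable.
Qed.
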